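(* Let $G=SU(n)$ with $n\geq 2$, let $\mathfrak g=\mathfrak{su}(n)$, let $c\in\mathbb R\setminus\{0\}$, and put $\langle\cdot,\cdot\rangle := c\cdot\mathcal K$, where $\mathcal K$ is the Killing form of $\mathfrak{su}(n)$. Let $\Psi$ be the (2-shifted symplectic) form on $BG_\bullet$ $$\Psi=\left(0,\; -\tfrac16\langle \omega^l,[\omega^l\wedge\omega^l]\rangle,\; \langle d_0^*\omega^l, d_2^*\omega^r\rangle,\;0,\;0\right),$$ and let $\Phi$ be the representative of the first Pontryagin class of $BG_\bullet$ $$\Phi=\left(0,\;\tfrac{1}{24\pi^2}\mathrm{Tr}(\omega^l\cdot\omega^l\cdot\omega^l),\;\tfrac{1}{8\pi^2}\mathrm{Tr}(d_2^*\omega^r\cdot d_0^*\omega^l),\;0,\;0\right),$$ both regarded as elements of $\Omega^4(BG_0)\oplus\Omega^3(BG_1)\oplus\Omega^2(BG_2)\oplus\Omega^1(BG_3)\oplus\Omega^0(BG_4)$. Then $$-\frac{1}{16\,n\,c\,\pi^2}\,\Psi=\Phi .$$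
   Context: $BG_\bullet$ is the nerve of $G$: $BG_0=\{\ast\}$, $BG_n=G^n$; the relevant face maps $BG_2\to BG_1=G$ are $d_0(g_1,g_2)=g_2$ and $d_2(g_1,g_2)=g_1$. $\omega^l$ and $\omega^r$ are the left and right Maurer-Cartan forms of $G$: for $X\in T_AG$ (in matrix form), $\omega^l(X)=A^{-1}X$ and $\omega^r(X)=XA^{-1}$. $\mathcal K(X,Y)=\mathrm{Tr}_{\mathbb R}(\mathrm{ad}_X\circ \mathrm{ad}_Y)$, where $\mathrm{ad}_X=[X,\cdot]$ is an $\mathbb R$-linear endomorphism of $\mathfrak g$; $\mathrm{Tr}$ of a matrix is the usual trace. Wedge conventions: for a $V$-valued $j$-form $\phi$ and a $W$-valued $k$-form $\psi$, $(\phi\wedge\psi)(v_1,\dots,v_{j+k})=\frac{1}{j!k!}\sum_{\sigma\in\mathfrak S_{j+k}}\mathrm{sign}(\sigma)\,\phi(v_{\sigma(1)},\dots,v_{\sigma(j)})\otimes\psi(v_{\sigma(j+1)},\dots,v_{\sigma(j+k)})$; for Lie algebra valued forms, $[\phi\wedge\psi]$ is given by the same formula with $\otimes$ replaced by the Lie bracket. For a multilinear map $f$ and vector-valued forms $\phi_1,\dots,\phi_k$, $f(\phi_1,\dots,\phi_k)$ means the linear map induced by $f$ on the tensor product composed with $\phi_1\wedge\dots\wedge\phi_k$. Thus $\langle\phi,\psi\rangle=\langle\cdot,\cdot\rangle\circ(\phi\wedge\psi)$, $\mathrm{Tr}(\phi\cdot\psi)$ comes from the bilinear map $(A,B)\mapsto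 \mathrm{Tr}(AB)$, and $\mathrm{Tr}(\phi\cdot\psi\cdot\chi)$ from $(A,B,C)\mapsto\mathrm{Tr}(ABC)$. *)

(* Defs.v *)
From HB Require Import structures.
From mathcomp Require Import all_boot all_order all_algebra all_fingroup.
From mathcomp Require Import all_classical all_reals all_analysis.
From mathcomp.real_closed Require Import complex.

Set Implicit Arguments.
Unset Strict Implicit.
Unset Printing Implicit Defensive.

Import Order.TTheory GRing.Theory Num.Theory.
Import numFieldNormedType.Exports.
Import passmx.
Local Open Scope ring_scope.
Local Open Scope complex_scope.
Local Open Scope sesquilinear_scope.

Section RcomplexVector.
Variable R : rcfType.

Fact Rcomplex_vect_iso : Vector.axiom 2 (Rcomplex R).
Proof.
exists (fun z : Rcomplex R => \row_(i < 2) if i == ord0 then complex.Re z else complex.Im z).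
  by move=> a [x y] [z t]; apply/rowP => i; rewrite !mxE; case: ifP.
exists (fun v : 'rV[R]_2 => (v 0 0 +i* v 0 1)%C).
  by case=> x y; rewrite !mxE.
move=> v; apply/rowP => i; rewrite mxE; case: ifP => [/eqP -> //|].
by case: i => [[|[|//]] //= Hi] _; congr (v _ _); apply/val_inj.
Qed.

HB.instance Definition _ :=
  Lmodule_hasFinDim.Build R (Rcomplex R) Rcomplex_vect_iso.
End RcomplexVector.

(* The complex n x n matrices regarded as a real vector space: 'M[R[i]]_n only *)
(* carries the complex scaling, hence the alias.                               *)
Definition cmx (R : rcfType) (n : nat) : Type := 'M[R[i]]_n.

Section ComplexMatrices.
Variables (R : rcfType) (n : nat).
Local Notation M := (cmx R n).

HB.instance Definition _ := GRing.Zmodule.copy M 'M[R[i]]_n.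

Definition cmx_scale (a : R) (A : M) : M := (a%:C : R[i]) *: (A : 'M[R[i]]_n).

Fact cmx_scaleA a b A : cmx_scale a (cmx_scale b A) = cmx_scale (a * b) A.
Proof. by rewrite /cmx_scale scalerA -rmorphM. Qed.

Fact cmx_scale1 : left_id 1 cmx_scale.
Proof. by move=> A; rewrite /cmx_scale scale1r. Qed.

Fact cmx_scaleDr : right_distributive cmx_scale +%R.
Proof. by move=> a A B; rewrite /cmx_scale scalerDr. Qed.

Fact cmx_scaleDl A : {morph cmx_scale^~ A : a b / a + b}.
Proof. by move=> a b; rewrite /cmx_scale rmorphD scalerDl. Qed.

HB.instance Definition _ := GRing.Zmodule_isLmodule.Build R M
  cmx_scaleA cmx_scale1 cmx_scaleDr cmx_scaleDl.

Lemma cmxZE (a : R) (A : M) : a *: A = (a%:C : R[i]) *: (A : 'M[R[i]]_n).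
Proof. by []. Qed.

Fact cmx_vect_iso : Vector.axiom (n * n + n * n) M.
Proof.
exists (fun A : M => row_mx (mxvec (map_mx (@complex.Re R) (A : 'M[R[i]]_n)))
                            (mxvec (map_mx (@complex.Im R) (A : 'M[R[i]]_n)))).
  move=> a A B.
  have E i j : (a *: A + B : 'M[R[i]]_n) i j =
      (a%:C * (A : 'M[R[i]]_n) i j + (B : 'M[R[i]]_n) i j) by rewrite cmxZE !mxE.
  rewrite scale_row_mx add_row_mx -!linearP.
  by congr row_mx; congr mxvec; apply/matrixP => i j;
    rewrite mxE [in RHS]mxE [in RHS]mxE E ![map_mx _ _ _ _]mxE;
    case: ((A : 'M[R[i]]_n) i j) => x y; case: ((B : 'M[R[i]]_n) i j) => z t /=;
    rewrite mul0r ?subr0 ?addr0.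
exists (fun v : 'rV[R]_(n * n + n * n) => \matrix_(i, j)
   (Complex (vec_mx (lsubmx v) i j) (vec_mx (rsubmx v) i j)) : M).
  move=> A; apply/matrixP => i j; rewrite mxE row_mxKl row_mxKr !mxvecK !mxE.
  by case: (A i j).
move=> v; rewrite -[RHS]hsubmxK; congr row_mx; apply: (can_inj vec_mxK);
  rewrite mxvecK; by apply/matrixP => i j; rewrite !mxE.
Qed.

HB.instance Definition _ := Lmodule_hasFinDim.Build R M cmx_vect_iso.

Definition cmul (A B : M) : M := A *m B.

Fact cmul_bilinear : bilinear_for
  (GRing.Scale.Law.clone _ _ *:%R _) (GRing.Scale.Law.clone _ _ *:%R _) cmul.
Proof.
split=> B a A A'; rewrite /cmul !cmxZE.
  by rewrite mulmxDl -scalemxAl.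
by rewrite mulmxDr -scalemxAr.
Qed.

HB.instance Definition _ :=
  bilinear_isBilinear.Build R M M M _ _ cmul cmul_bilinear.

Lemma cmulA (A B C : M) : cmul A (cmul B C) = cmul (cmul A B) C.
Proof. exact: mulmxA. Qed.

Lemma cmul1l (A : M) : cmul (1%:M : 'M[R[i]]_n) A = A.
Proof. exact: mul1mx. Qed.

HB.instance Definition _ (A : M) := GRing.isLinear.Build R M M _ (cmul A)
  (fun a B C => linearPr _ _ _ _ _).

Definition cinv (A : M) : M := invmx (A : 'M[R[i]]_n).

Definition ctrace (A : M) : Rcomplex R := \tr (A : 'M[R[i]]_n).

Fact ctrace_linear : linear ctrace.
Proof.
move=> a A B; rewrite /ctrace linearD /= cmxZE linearZ /=; congr (_ + _).
by case: (\tr _) => x y /=; rewrite /GRing.scale /= /GRing.mul /= !mul0r subr0 addr0.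
Qed.
HB.instance Definition _ := GRing.isLinear.Build R M (Rcomplex R) _ ctrace
  ctrace_linear.

Lemma ctrace_mulC (A B : M) : ctrace (cmul A B) = ctrace (cmul B A).
Proof. exact: mxtrace_mulC. Qed.

(* The conjugate transpose. *)
Definition cadj (A : M) : M := (A : 'M[R[i]]_n)^t*.

Fact cadj_linear : linear cadj.
Proof.
move=> a A B; rewrite /cadj !cmxZE.
apply/matrixP => i j; rewrite !mxE rmorphD rmorphM /=; congr (_ * _ + _).
by apply/eqP; rewrite eq_complex /= oppr0 !eqxx.
Qed.
HB.instance Definition _ := GRing.isLinear.Build R M M _ cadj cadj_linear.

Lemma cadjM (A B : M) : cadj (cmul A B) = cmul (cadj B) (cadj A).
Proof. by rewrite /cadj /cmul trmx_mul map_mxM. Qed.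

Lemma cadjK (A : M) : cadj (cadj A) = A.
Proof. exact: trmxCK. Qed.

End ComplexMatrices.

Section SpecialUnitary.
Variables (R : rcfType) (n : nat).
Local Notation M := (cmx R n).

(* su(n): the X with X^* + X = 0 and Tr X = 0, as a real subspace. *)
Definition su : {vspace M} :=
  (lker (linfun (@cadj R n) + \1%VF)%R :&: lker (linfun (@ctrace R n)))%VS.

Lemma suP (X : M) : reflect (cadj X = - X /\ ctrace X = 0) (X \in su).
Proof.
rewrite memv_cap !memv_ker !lfunE /= !lfunE /=; apply: (iffP andP).
  by move=> [/eqP h1 /eqP h2]; split=> //; apply/eqP; rewrite -addr_eq0 h1.
by move=> [-> h]; rewrite addNr; split=> //; apply/eqP; exact: h.
Qed.

Local Notation su_t := (subvs_of su).

Definition commutator (X Y : M) : M := cmul X Y - cmul Y X.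

Fact commutator_su (X Y : M) : X \in su -> Y \in su -> commutator X Y \in su.
Proof.
move=> /suP[hX _] /suP[hY _]; apply/suP; split; last first.
  by rewrite /commutator linearB /= ctrace_mulC subrr.
rewrite /commutator linearB /=.
by rewrite !cadjM hX hY !linearNl !linearNr !opprK opprB.
Qed.

Definition su_bracket (X Y : su_t) : su_t :=
  Subvs (commutator_su (subvsP X) (subvsP Y)).

Fact su_bracket_bilinear : bilinear_for
  (GRing.Scale.Law.clone _ _ *:%R _) (GRing.Scale.Law.clone _ _ *:%R _)
  su_bracket.
Proof.
split=> Z a X Y; apply/val_inj; rewrite /= /commutator !linearPl !linearPr /=;
  by rewrite scalerBr opprD addrACA.
Qed.

HB.instance Definition _ :=
  bilinear_isBilinear.Build R su_t su_t su_t _ _ su_bracket su_bracket_bilinear.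

HB.instance Definition _ (X : su_t) :=
  GRing.isLinear.Build R su_t su_t _ (su_bracket X)
  (fun a Y Z => linearPr _ _ _ _ _).

Definition ad (X : su_t) : 'End(su_t) := linfun (su_bracket X).
End SpecialUnitary.

Section IteratedDerivatives.
Variables (R : realType) (N : nat).

(* C^k: all iterated directional derivatives of length at most k exist and    *)
(* are continuous.                                                             *)
Fixpoint Ck (k : nat) (f : 'rV[R]_N -> R) : Prop :=
  continuous f /\
  if k is k'.+1 then
    forall v : 'rV[R]_N, (forall x, derivable f x v) /\ Ck k' ('D_v f)
  else True.
End IteratedDerivatives.

Section Smooth.
Variable R : realType.

(* Smoothness on a finite-dimensional real vector space, read in linear        *)
(* coordinates; it does not depend on the basis.                               *)
Definition smooth (E : vectType R) (F : E -> R) : Prop :=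
  forall k, Ck k (F \o vecof (vbasis {:E})).

Lemma Ck_pred N k (f : 'rV[R]_N -> R) : Ck k.+1 f -> Ck k f.
Proof.
elim: k f => [|k IH] f; first by case.
move=> [cf df]; split=> // v; have [dfv Cf] := df v; split=> //; exact: IH.
Qed.

Lemma Ck_cst N k (a : R) : Ck k (fun _ : 'rV[R]_N => a).
Proof.
elim: k a => [|k IH] a; split => //; try exact: cst_continuous.
move=> v; split=> [x|]; first exact: derivable_cst.
by rewrite (_ : 'D_v _ = fun=> 0) //; apply/funext => x; exact: derive_cst.
Qed.

Lemma CkD N k (f g : 'rV[R]_N -> R) : Ck k f -> Ck k g ->
  Ck k (fun x => f x + g x).
Proof.
elim: k f g => [|k IH] f g [cf df] [cg dg]; split => //.
- by move=> x; apply: continuousD; [exact: cf | exact: cg].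
- by move=> x; apply: continuousD; [exact: cf | exact: cg].
move=> v; have [dfv Cf] := df v; have [dgv Cg] := dg v.
split=> [x|]; first exact: derivableD.
rewrite (_ : 'D_v _ = fun x => 'D_v f x + 'D_v g x); first exact: IH.
by apply/funext => x; exact: deriveD.
Qed.

Lemma CkM N k (f g : 'rV[R]_N -> R) : Ck k f -> Ck k g ->
  Ck k (fun x => f x * g x).
Proof.
elim: k f g => [|k IH] f g Ckf Ckg; have [cf df] := Ckf; have [cg dg] := Ckg;
  split => //.
- by move=> x; apply: continuousM; [exact: cf | exact: cg].
- by move=> x; apply: continuousM; [exact: cf | exact: cg].
move=> v; have [dfv Cf] := df v; have [dgv Cg] := dg v.
split=> [x|]; first exact: derivableM.
rewrite (_ : 'D_v _ = fun x => f x * 'D_v g x + g x * 'D_v f x).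
  by apply: CkD; apply: IH => //; exact: Ck_pred.
by apply/funext => x; exact: deriveM.
Qed.

Lemma Ck_coord N k (i : 'I_N) : Ck k (fun x : 'rV[R]_N => x 0 i).
Proof.
case: k => [|k]; split; try exact: coord_continuous; first by [].
move=> v.
have H x : is_derive x v (fun x : 'rV[R]_N => x 0 i) (v 0 i).
  have @l : {linear 'rV[R]_N -> R}.
    by exists (fun x : 'rV[R]_N => x 0 i); do 2![eexists];
      do ?[constructor]; rewrite ?mxE// => ? *; rewrite ?mxE//; move=> ?;
      rewrite !mxE.
  have cl : continuous l by exact: coord_continuous.
  have dl : differentiable l x by exact/linear_differentiable.
  apply: DeriveDef; first exact: diff_derivable.
  by rewrite -[LHS]/('D_v l x) deriveE // diff_lin.
split=> [x|]; first by have [] := H x.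
rewrite (_ : 'D_v _ = fun=> v 0 i); first exact: Ck_cst.
by apply/funext => x; have [_ ] := H x.
Qed.

Lemma Ck_comp N N' k (f : 'rV[R]_N' -> R) (L : {linear 'rV[R]_N -> 'rV[R]_N'}) :
  Ck k f -> Ck k (f \o L).
Proof.
have cL : continuous L.
  have -> : L = (fun x => \sum_i x 0 i *: L (delta_mx 0 i)) :> (_ -> _).
    apply/funext => x; rewrite [in LHS](row_sum_delta x) linear_sum.
    by apply: eq_bigr => i _; rewrite linearZ.
  apply: continuous_big => [|i _ x]; first exact: add_continuous.
  have := @continuous_comp _ _ _ (fun y : 'rV[R]_N => y 0 i)
    (fun a : R => a *: L (delta_mx 0 i)) x.
  by apply; [exact: coord_continuous | exact: scalel_continuous].
elim: k f => [|k IH] f [cf df]; split => //.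
- by move=> x; apply: continuous_comp; [exact: cL | exact: cf].
- by move=> x; apply: continuous_comp; [exact: cL | exact: cf].
move=> v; have [dfv Cf] := df (L v).
have E x : (fun h : R => h^-1 *: (((f \o L) \o shift x) (h *: v) - (f \o L) x)) =
           (fun h : R => h^-1 *: ((f \o shift (L x)) (h *: L v) - f (L x))).
  by apply/funext => h /=; rewrite linearP.
split=> [x|]; first by rewrite /derivable E; exact: dfv.
rewrite (_ : 'D_v _ = 'D_(L v) f \o L); first exact: IH.
by apply/funext => x; rewrite /derive E.
Qed.

Variable E : vectType R.

Lemma smooth_cst (a : R) : smooth (fun _ : E => a).
Proof. by move=> k; exact: Ck_cst. Qed.

Lemma smoothD (F G : E -> R) : smooth F -> smooth G ->
  smooth (fun x => F x + G x).
Proof. by move=> sF sG k; exact: CkD. Qed.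

Lemma smoothM (F G : E -> R) : smooth F -> smooth G ->
  smooth (fun x => F x * G x).
Proof. by move=> sF sG k; exact: CkM. Qed.

Lemma smooth_sum I (r : seq I) (P : pred I) (F : I -> E -> R) :
  (forall i, P i -> smooth (F i)) -> smooth (fun x => \sum_(i <- r | P i) F i x).
Proof.
move=> sF; elim: r => [|i r IH].
  by rewrite (_ : (fun _ => _) = fun=> 0);
    [exact: smooth_cst | apply/funext => x; rewrite big_nil].
case Pi: (P i).
  rewrite (_ : (fun _ => _) = fun x => F i x + \sum_(i <- r | P i) F i x).
    by apply: smoothD; first exact: sF.
  by apply/funext => x; rewrite big_cons Pi.
by rewrite (_ : (fun _ => _) = fun x => \sum_(i <- r | P i) F i x) //;
  apply/funext => x; rewrite big_cons Pi.
Qed.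

Lemma smooth_comp (E' : vectType R) (F : E' -> R) (L : {linear E -> E'}) :
  smooth F -> smooth (F \o L).
Proof.
move=> sF k.
have -> : (F \o L) \o vecof (vbasis {:E}) = (F \o vecof (vbasis {:E'})) \o
    (rVof (vbasis {:E'}) \o L \o vecof (vbasis {:E})).
  by apply/funext => x /=; rewrite rVofK // vbasisP.
exact: (Ck_comp _ (sF k)).
Qed.

Lemma smooth_linear (l : {linear E -> R^o}) : smooth l.
Proof.
move=> k; have -> : l \o vecof (vbasis {:E}) =
    fun x => \sum_i x 0 i * l (vecof (vbasis {:E}) (delta_mx 0 i)).
  apply/funext => x /=; rewrite /vecof linear_sum; apply: eq_bigr => i _.
  by rewrite linearZ -[\sum_(_ < _) _]/(vecof _ _) vecof_delta.
elim: (index_enum _) => [|i r IH].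
  by rewrite (_ : (fun _ => _) = fun=> 0);
    [exact: Ck_cst | apply/funext => x; rewrite big_nil].
rewrite (_ : (fun _ => _) = fun x : 'rV_ _ => x 0 i * l (vecof (vbasis {:E}) (delta_mx 0 i)) +
    \sum_(i <- r) x 0 i * l (vecof (vbasis {:E}) (delta_mx 0 i))).
  by apply: CkD IH; apply: CkM; [exact: Ck_coord | exact: Ck_cst].
by apply/funext => x; rewrite big_cons.
Qed.
End Smooth.

(* The trace of an endomorphism; it does not depend on the basis. *)
Definition lftrace (K : fieldType) (V : vectType K) (f : 'End(V)) : K :=
  \tr (mxof (vbasis {:V}) (vbasis {:V}) f).

Section Killing.
Variables (R : rcfType) (n : nat).
Local Notation M := (cmx R n).
Local Notation su_t := (subvs_of (su R n)).

Definition killing (X Y : su_t) : R := lftrace (ad X \o ad Y)%VF.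

Definition pairing (c : R) (X Y : su_t) : R^o := c * killing X Y.

Fact ad_linear : linear (@ad R n).
Proof.
by move=> a X Y; apply/lfunP => Z; rewrite add_lfunE scale_lfunE /ad !lfunE /= linearPl.
Qed.

Fact lftrace_linear (V : vectType R) : linear (@lftrace R V : 'End(V) -> R^o).
Proof. by move=> a f g; rewrite /lftrace !linearP. Qed.

Fact pairing_bilinear c : bilinear_for
  (GRing.Scale.Law.clone _ _ *:%R _) (GRing.Scale.Law.clone _ _ *:%R _)
  (pairing c).
Proof.
split=> Z a X Y; rewrite /pairing /killing ad_linear.
  by rewrite comp_lfunDl -comp_lfunZl lftrace_linear mulrDr mulrCA.
by rewrite comp_lfunDr -comp_lfunZr lftrace_linear mulrDr mulrCA.
Qed.
HB.instance Definition _ c :=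
  bilinear_isBilinear.Build R su_t su_t R^o _ _ (pairing c) (pairing_bilinear c).

Definition trmul (A B : M) : Rcomplex R := ctrace (cmul A B).

Fact trmul_bilinear : bilinear_for
  (GRing.Scale.Law.clone _ _ *:%R _) (GRing.Scale.Law.clone _ _ *:%R _) trmul.
Proof.
by split=> B a A A'; rewrite /trmul ?linearPl ?linearPr linearP.
Qed.
HB.instance Definition _ :=
  bilinear_isBilinear.Build R M M (Rcomplex R) _ _ trmul trmul_bilinear.
End Killing.

Section Nerve.
Variables (R : realType) (n : nat).
Local Notation M := (cmx R n).
Local Notation su_t := (subvs_of (su R n)).

Record SU := MkSU {
  SU_mx :> M;
  SU_unitary : (SU_mx : 'M[R[i]]_n) \is unitarymx;
  SU_det : \det (SU_mx : 'M[R[i]]_n) = 1 }.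

(* T_A SU(n) = A su(n), as a real subspace of the complex matrices. *)
Definition tangentSU (A : SU) : {vspace M} := (linfun (cmul A) @: su R n)%VS.

Lemma tangentSUP (A : SU) (X : M) :
  reflect (exists2 Y : M, Y \in su R n & X = cmul A Y) (X \in tangentSU A).
Proof.
apply: (iffP memv_imgP) => -[Y Ysu ->]; exists Y => //; by rewrite lfunE.
Qed.

Lemma invSU (A : SU) : cmul (cinv A) A = 1%:M.
Proof. by rewrite /cmul /cinv mulVmx // unitarymx_unit // SU_unitary. Qed.

Lemma invSU_adj (A : SU) : cinv A = cadj A.
Proof. by rewrite /cinv invmx_unitary // SU_unitary. Qed.

Fact mc_left_subproof (A : SU) (X : M) : X \in tangentSU A ->
  cmul (cinv A) X \in su R n.
Proof.
by move=> /tangentSUP[Y Ysu ->]; rewrite cmulA invSU cmul1l.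
Qed.

Lemma Ad_su (A : SU) (Y : M) : Y \in su R n ->
  cmul (cmul A Y) (cadj A) \in su R n.
Proof.
move=> /suP[hY tY]; apply/suP; split.
  by rewrite !cadjM cadjK hY linearNl linearNr /= cmulA.
by rewrite ctrace_mulC -invSU_adj cmulA invSU cmul1l.
Qed.

Fact mc_right_subproof (A : SU) (X : M) : X \in tangentSU A ->
  cmul X (cinv A) \in su R n.
Proof. by move=> /tangentSUP[Y Ysu ->]; rewrite invSU_adj Ad_su. Qed.

(* BG_p = G^p, a singleton for p = 0. *)
Definition nerve (p : nat) : Type := {ffun 'I_p -> SU}.

Definition ffun_eval p (i : 'I_p) (v : {ffun 'I_p -> M}) : M := v i.
Fact ffun_eval_linear p (i : 'I_p) : linear (ffun_eval i).
Proof. by move=> a u v; rewrite /ffun_eval !ffunE. Qed.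
HB.instance Definition _ p (i : 'I_p) :=
  GRing.isLinear.Build R {ffun 'I_p -> M} M _ (ffun_eval i) (ffun_eval_linear i).

(* The tangent space of G^p at g: the p-tuples of matrices whose i-th entry   *)
(* is tangent to SU(n) at g i.                                                 *)
Definition tangent p (g : nerve p) : {vspace {ffun 'I_p -> M}} :=
  (\bigcap_(i < p) (linfun (ffun_eval i) @^-1: tangentSU (g i)))%VS.

Lemma tangentP p (g : nerve p) (v : {ffun 'I_p -> M}) :
  reflect (forall i, v i \in tangentSU (g i)) (v \in tangent g).
Proof.
have E : (v \in tangent g) =
    [forall i, v \in (linfun (ffun_eval i) @^-1: tangentSU (g i))%VS].
  apply/idP/forallP => [vg i|vg].
    by move: vg; rewrite !memvE => /subv_trans; apply; exact: (bigcapv_inf i).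
  by rewrite memvE; apply/subv_bigcapP => i _; rewrite -memvE.
rewrite E; apply: (iffP forallP) => h i; have := h i;
  by rewrite -memv_preim lfunE.
Qed.
End Nerve.

Section SmoothOnNerve.
Variables (R : realType) (n p : nat).
Local Notation M := (cmx R n).
Local Notation su_t := (subvs_of (su R n)).
Local Notation BG := (nerve R n).

Definition nerve_mx (g : BG p) : {ffun 'I_p -> M} := [ffun i => g i : M].

(* G^p is a closed embedded submanifold of the p-tuples of matrices, so the   *)
(* smooth functions on it are the restrictions of the smooth ambient ones.    *)
Definition smooth_fun (f : BG p -> R) : Prop :=
  exists2 F : {ffun 'I_p -> M} -> R, smooth F & forall g, f g = F (nerve_mx g).

(* V is finite-dimensional: smoothness can be tested by linear functionals.    *)
Definition smooth_map (V : vectType R) (f : BG p -> V) : Prop :=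
  forall l : {linear V -> R^o}, smooth_fun (l \o f).

Lemma smooth_fun_cst (a : R) : smooth_fun (fun=> a).
Proof. by exists (fun=> a) => //; exact: smooth_cst. Qed.

Lemma smooth_funM (f h : BG p -> R) : smooth_fun f -> smooth_fun h ->
  smooth_fun (fun g => f g * h g).
Proof.
move=> [F sF EF] [H sH EH]; exists (fun x => F x * H x).
  exact: smoothM.
by move=> g; rewrite EF EH.
Qed.

Lemma smooth_funD (f h : BG p -> R) : smooth_fun f -> smooth_fun h ->
  smooth_fun (fun g => f g + h g).
Proof.
move=> [F sF EF] [H sH EH]; exists (fun x => F x + H x).
  exact: smoothD.
by move=> g; rewrite EF EH.
Qed.

Lemma smooth_fun_sum I (r : seq I) (f : I -> BG p -> R) :
  (forall i, smooth_fun (f i)) -> smooth_fun (fun g => \sum_(i <- r) f i g).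
Proof.
move=> sf; elim: r => [|i r IH].
  by rewrite (_ : (fun _ => _) = fun=> 0);
    [exact: smooth_fun_cst | apply/funext => x; rewrite big_nil].
rewrite (_ : (fun _ => _) = fun x => f i x + \sum_(i <- r) f i x).
  by apply: smooth_funD.
by apply/funext => x; rewrite big_cons.
Qed.

Lemma smooth_map_cst (V : vectType R) (a : V) : smooth_map (fun=> a).
Proof. by move=> l; exact: smooth_fun_cst. Qed.

Lemma smooth_mapD (V : vectType R) (f h : BG p -> V) :
  smooth_map f -> smooth_map h -> smooth_map (fun g => f g + h g).
Proof.
move=> sf sh l; rewrite (_ : l \o _ = fun g => l (f g) + l (h g)).
  by apply: smooth_funD; [exact: sf | exact: sh].
by apply/funext => g /=; rewrite linearD.
Qed.

Lemma smooth_mapZ (V : vectType R) (a : R) (f : BG p -> V) :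
  smooth_map f -> smooth_map (fun g => a *: f g).
Proof.
move=> sf l; rewrite (_ : l \o _ = fun g => a * l (f g)).
  by apply: smooth_funM; [exact: smooth_fun_cst | exact: sf].
by apply/funext => g /=; rewrite linearZ.
Qed.

Lemma smooth_map_sum (V : vectType R) I (r : seq I) (f : I -> BG p -> V) :
  (forall i, smooth_map (f i)) -> smooth_map (fun g => \sum_(i <- r) f i g).
Proof.
move=> sf l; rewrite (_ : l \o _ = fun g => \sum_(i <- r) l (f i g)).
  by apply: smooth_fun_sum => i; exact: sf.
by apply/funext => g /=; rewrite linear_sum.
Qed.

Lemma smooth_map_linear (V W : vectType R) (h : {linear V -> W})
  (f : BG p -> V) : smooth_map f -> smooth_map (h \o f).
Proof. by move=> sf l; exact: (sf (l \o h : {linear V -> R^o})). Qed.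

Lemma smooth_map_bilinear (U V W : vectType R) (B : {bilinear U -> V -> W})
    (f : BG p -> U) (h : BG p -> V) :
  smooth_map f -> smooth_map h -> smooth_map (fun g => B (f g) (h g)).
Proof.
move=> sf sh.
rewrite (_ : (fun g => _) = fun g => \sum_i \sum_j
    (coord (vbasis {:U}) i (f g) * coord (vbasis {:V}) j (h g)) *:
      B (vbasis {:U})`_i (vbasis {:V})`_j).
  apply: smooth_map_sum => i; apply: smooth_map_sum => j l.
  rewrite (_ : l \o _ = fun g =>
    (coord (vbasis {:U}) i (f g) * coord (vbasis {:V}) j (h g)) *
      l (B (vbasis {:U})`_i (vbasis {:V})`_j)).
    apply: smooth_funM; last exact: smooth_fun_cst.
    apply: smooth_funM.
      exact: (sf (coord (vbasis {:U}) i : {linear U -> R^o})).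
    exact: (sh (coord (vbasis {:V}) j : {linear V -> R^o})).
  by apply/funext => g /=; rewrite linearZ.
apply/funext => g.
rewrite {1}(coord_vbasis (memvf (f g))) linear_sumlz.
apply: eq_bigr => i _; rewrite {1}(coord_vbasis (memvf (h g))) linear_sumr.
by apply: eq_bigr => j _; rewrite linearZl_LR linearZr_LR scalerA.
Qed.

Lemma smooth_map_coord (i : 'I_p) : smooth_map (fun g : BG p => g i : M).
Proof.
move=> l; exists (l \o ffun_eval i : {linear _ -> R^o}).
  exact: smooth_linear.
by move=> g /=; rewrite /ffun_eval ffunE.
Qed.
End SmoothOnNerve.

Section Forms.
Variables (R : realType) (n : nat).
Local Notation M := (cmx R n).
Local Notation su_t := (subvs_of (su R n)).
Local Notation BG := (nerve R n).

Fact left_inv_subproof p (g : BG p) (xi : {ffun 'I_p -> su_t}) :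
  [ffun i => cmul (g i) (vsval (xi i))] \in tangent g.
Proof.
apply/tangentP => i; rewrite ffunE; apply/tangentSUP.
by exists (vsval (xi i)) => //; exact: subvsP.
Qed.

(* The left-invariant vector field on G^p generated by xi. *)
Definition left_inv p (xi : {ffun 'I_p -> su_t}) (g : BG p) :
  subvs_of (tangent g) := Subvs (left_inv_subproof g xi).

(* v with its i-th entry replaced by x. *)
Definition upd k (T : Type) (v : 'I_k -> T) (i : 'I_k) (x : T) : 'I_k -> T :=
  fun j => if j == i then x else v j.

Section TensorFields.
Variables (p k : nat) (V : vectType R).

(* Families, indexed by the points g of BG_p, of V-valued functions of k       *)
(* tangent vectors at g.                                                       *)
Definition tfield : Type := forall g : BG p, ('I_k -> subvs_of (tangent g)) -> V.

HB.instance Definition _ := gen_eqMixin tfield.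
HB.instance Definition _ := gen_choiceMixin tfield.

Definition tfield_add (phi psi : tfield) : tfield := fun g v => phi g v + psi g v.
Definition tfield_opp (phi : tfield) : tfield := fun g v => - phi g v.
Definition tfield_zero : tfield := fun g v => 0.
Definition tfield_scale (a : R) (phi : tfield) : tfield := fun g v => a *: phi g v.

Lemma tfieldP (phi psi : tfield) : (forall g v, phi g v = psi g v) -> phi = psi.
Proof.
by move=> h; apply: functional_extensionality_dep => g; apply/funext => v.
Qed.

Fact tfield_addA : associative tfield_add.
Proof. by move=> f g h; apply: tfieldP => x v; exact: addrA. Qed.
Fact tfield_addC : commutative tfield_add.
Proof. by move=> f g; apply: tfieldP => x v; exact: addrC. Qed.
Fact tfield_add0 : left_id tfield_zero tfield_add.
Proof. by move=> f; apply: tfieldP => x v; exact: add0r. Qed.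
Fact tfield_addN : left_inverse tfield_zero tfield_opp tfield_add.
Proof. by move=> f; apply: tfieldP => x v; exact: addNr. Qed.
HB.instance Definition _ := GRing.isZmodule.Build tfield
  tfield_addA tfield_addC tfield_add0 tfield_addN.

Fact tfield_scaleA a b f : tfield_scale a (tfield_scale b f) = tfield_scale (a * b) f.
Proof. by apply: tfieldP => x v; exact: scalerA. Qed.
Fact tfield_scale1 : left_id 1 tfield_scale.
Proof. by move=> f; apply: tfieldP => x v; exact: scale1r. Qed.
Fact tfield_scaleDr : right_distributive tfield_scale +%R.
Proof. by move=> a f g; apply: tfieldP => x v; exact: scalerDr. Qed.
Fact tfield_scaleDl f : {morph tfield_scale^~ f : a b / a + b}.
Proof. by move=> a b; apply: tfieldP => x v; exact: scalerDl. Qed.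
HB.instance Definition _ := GRing.Zmodule_isLmodule.Build R tfield
  tfield_scaleA tfield_scale1 tfield_scaleDr tfield_scaleDl.

Definition multilinear_field (phi : tfield) : Prop :=
  forall g v i a x y, phi g (upd v i (a *: x + y)) =
    a *: phi g (upd v i x) + phi g (upd v i y).

Definition alternating_field (phi : tfield) : Prop :=
  forall g (v : 'I_k -> subvs_of (tangent g)) i j,
    i != j -> v i = v j -> phi g v = 0.

(* The left-invariant fields form a global frame of the tangent bundle. *)
Definition smooth_field (phi : tfield) : Prop :=
  forall xi : 'I_k -> {ffun 'I_p -> su_t},
    smooth_map (fun g => phi g (fun a => left_inv (xi a) g)).

Definition is_form : {pred tfield} := fun phi =>
  `[< [/\ multilinear_field phi, alternating_field phi & smooth_field phi] >].

Lemma is_formP (phi : tfield) :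
  reflect [/\ multilinear_field phi, alternating_field phi & smooth_field phi]
          (phi \in is_form).
Proof. exact: asboolP. Qed.

Fact is_form_submod_closed : submod_closed is_form.
Proof.
split.
  apply/is_formP; split.
  - by move=> g v i a x y; rewrite [RHS]addr0 scaler0.
  - by [].
  - by move=> xi; exact: smooth_map_cst.
move=> a f h /is_formP[mf af sf] /is_formP[mh ah sh]; apply/is_formP; split.
- move=> g v i b x y.
  change (a *: f g (upd v i (b *: x + y)) + h g (upd v i (b *: x + y)) =
    b *: (a *: f g (upd v i x) + h g (upd v i x)) +
      (a *: f g (upd v i y) + h g (upd v i y))).
  by rewrite mf mh !scalerDr !scalerA [b * a]mulrC addrACA.
- move=> g v i j ij e.
  change (a *: f g v + h g v = 0).
  by rewrite (af g v i j ij e) (ah g v i j ij e) scaler0 addr0.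
- move=> xi; apply: smooth_mapD (sh xi).
  exact: smooth_mapZ (sf xi).
Qed.
HB.instance Definition _ := GRing.isSubmodClosed.Build R tfield is_form
  is_form_submod_closed.

(* Omega^k(BG_p; V) *)
Record form : Type := Form {
  form_val :> tfield;
  form_subproof : form_val \in is_form }.

HB.instance Definition _ := [isSub for form_val].
HB.instance Definition _ := [Choice of form by <:].
HB.instance Definition _ := [SubChoice_isSubLmodule of form by <:].
End TensorFields.

Arguments form_val [p k V] _ g v.

Section Wedge.
Variables (p j k : nat) (U V W : vectType R) (B : {bilinear U -> V -> W}).

(* The linear map that B induces on the tensor product of U and V, composed   *)
(* with the wedge product of phi and psi.                                      *)
Definition wedge_field (phi : tfield p j U) (psi : tfield p k V) :
  tfield p (j + k) W := fun g v =>
  ((j`! * k`!)%:R : R)^-1 *: \sum_(s : 'S_(j + k)) ((-1) ^+ s : R) *: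
     B (phi g (fun a => v (s (lshift k a)))) (psi g (fun b => v (s (rshift j b)))).

Fact wedge_subproof (phi : form p j U) (psi : form p k V) :
  wedge_field phi psi \in @is_form p (j + k) W.
Proof.
case: phi => phi /= /is_formP[mphi _ sphi].
case: psi => psi /= /is_formP[mpsi _ spsi].
apply/is_formP; split.
- move=> g v i a x y; rewrite /wedge_field.
  rewrite scalerA [a * _]mulrC -scalerA -scalerDr; congr (_ *: _).
  rewrite scaler_sumr -big_split; apply: eq_bigr => s _.
  rewrite /= scalerA [a * _]mulrC -scalerA -scalerDr; congr (_ *: _).
  have [a0 Ea|b0 Eb] := split_ordP ((s^-1)%g i).
    have si : i = s (lshift k a0) by rewrite -Ea permKV.
    have El z : (fun c => upd v i z (s (lshift k c))) =
                upd (fun c => v (s (lshift k c))) a0 z.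
      apply/funext => c; rewrite /upd si (inj_eq perm_inj).
      by rewrite (inj_eq (@lshift_inj _ _)).
    have Er z : (fun c => upd v i z (s (rshift j c))) =
                (fun c => v (s (rshift j c))).
      by apply/funext => c; rewrite /upd si (inj_eq perm_inj) eq_rlshift.
    by rewrite !El !Er mphi linearPl.
  have si : i = s (rshift j b0) by rewrite -Eb permKV.
  have Er z : (fun c => upd v i z (s (rshift j c))) =
              upd (fun c => v (s (rshift j c))) b0 z.
    apply/funext => c; rewrite /upd si (inj_eq perm_inj).
    by rewrite (inj_eq (@rshift_inj _ _)).
  have El z : (fun c => upd v i z (s (lshift k c))) =
              (fun c => v (s (lshift k c))).
    by apply/funext => c; rewrite /upd si (inj_eq perm_inj) eq_lrshift.
  by rewrite !El !Er mpsi linearPr.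
- move=> g v i i' ii' e; rewrite /wedge_field.
  set S := \sum_s _; suff -> : S = 0 by rewrite scaler0.
  have vt x : v (tperm i i' x) = v x by case: tpermP => // ->.
  have : S = - S.
    rewrite {1}/S (reindex_inj (mulIg (tperm i i'))) /= -sumrN.
    apply: eq_bigr => s _; rewrite odd_permM odd_tperm ii' addbT.
    rewrite signrN scaleNr; congr (- (_ *: B (phi g _) (psi g _)));
      by apply/funext => c; rewrite permM vt.
  move/eqP; rewrite -addr_eq0 -mulr2n -scaler_nat scaler_eq0 pnatr_eq0 /=.
  by move/eqP.
- move=> xi; rewrite /wedge_field; apply: smooth_mapZ.
  apply: smooth_map_sum => s; apply: smooth_mapZ.
  apply: smooth_map_bilinear.
    exact: (sphi (fun a => xi (s (lshift k a)))).
  exact: (spsi (fun b => xi (s (rshift j b)))).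
Qed.

Definition wedge (phi : form p j U) (psi : form p k V) : form p (j + k) W :=
  Form (wedge_subproof phi psi).
End Wedge.

Section PostComposition.
Variables (p k : nat) (V W : vectType R) (h : {linear V -> W}).

Fact postcomp_subproof (phi : form p k V) :
  ((fun g v => h (form_val phi g v)) : tfield p k W) \in @is_form p k W.
Proof.
case: phi => phi /= /is_formP[mphi aphi sphi]; apply/is_formP; split.
- by move=> g v i a x y; rewrite mphi linearP.
- by move=> g v i i' ii' e; rewrite (aphi g v i i' ii' e) linear0.
- by move=> xi; exact: smooth_map_linear (sphi xi).
Qed.

Definition postcomp (phi : form p k V) : form p k W :=
  Form (postcomp_subproof phi).
End PostComposition.

Section Projections.
Variables (p q : nat) (s : 'I_p -> 'I_q).

Definition reindex_ffun (v : {ffun 'I_q -> M}) : {ffun 'I_p -> M} :=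
  [ffun i => v (s i)].
Fact reindex_ffun_linear : linear reindex_ffun.
Proof. by move=> a u v; apply/ffunP => i; rewrite !ffunE. Qed.
HB.instance Definition _ := GRing.isLinear.Build R
  {ffun 'I_q -> M} {ffun 'I_p -> M} _ reindex_ffun reindex_ffun_linear.

(* The projection G^q -> G^p that selects the factors s, and its differential  *)
(* dproj.                                                                      *)
Definition nerve_proj (g : BG q) : BG p := [ffun i => g (s i)].

Fact dproj_subproof (g : BG q) (v : subvs_of (tangent g)) :
  reindex_ffun (vsval v) \in tangent (nerve_proj g).
Proof.
apply/tangentP => i; rewrite !ffunE.
by have /tangentP := subvsP v; apply.
Qed.

Definition dproj (g : BG q) (v : subvs_of (tangent g)) :
  subvs_of (tangent (nerve_proj g)) := Subvs (dproj_subproof v).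

Fact pullback_subproof k (V : vectType R) (phi : form p k V) :
  ((fun g v => form_val phi (nerve_proj g) (fun a => dproj (v a))) : tfield q k V)
    \in @is_form q k V.
Proof.
case: phi => phi /= /is_formP[mphi aphi sphi]; apply/is_formP; split.
- move=> g v i a x y.
  have E z : (fun c => dproj (upd v i z c)) = upd (fun c => dproj (v c)) i (dproj z).
    by apply/funext => c; rewrite /upd; case: ifP.
  rewrite !E -mphi; congr (phi _ (upd _ _ _)).
  by apply/val_inj; rewrite /= !linearP.
- by move=> g v i i' ii' e; apply: (aphi _ _ i i' ii'); rewrite e.
- move=> xi l.
  have [F sF EF] := sphi (fun a => [ffun i => xi a (s i)]) l.
  exists (F \o reindex_ffun); first exact: smooth_comp.
  move=> g /=.
  rewrite (_ : reindex_ffun _ = nerve_mx (nerve_proj g)).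
    rewrite -EF /=; congr (l (phi _ _)); apply/funext => a; apply/val_inj => /=.
    by apply/ffunP => i; rewrite !ffunE.
  by apply/ffunP => i; rewrite !ffunE.
Qed.

Definition pullback k (V : vectType R) (phi : form p k V) : form q k V :=
  Form (pullback_subproof phi).
End Projections.

Section MaurerCartan.

(* The Maurer-Cartan forms X |-> A^-1 X and X |-> X A^-1 on BG_1 = G, at the   *)
(* point A = g ord0.                                                           *)
Definition mc_left_val (g : BG 1) (v : subvs_of (tangent g)) : su_t :=
  Subvs (mc_left_subproof (tangentP _ _ (subvsP v) ord0)).
Definition mc_right_val (g : BG 1) (v : subvs_of (tangent g)) : su_t :=
  Subvs (mc_right_subproof (tangentP _ _ (subvsP v) ord0)).

Lemma form1P (f : tfield 1 1 su_t) (h : forall g, subvs_of (tangent g) -> su_t) :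
  (forall g v, f g v = h g (v ord0)) -> (forall g, linear (h g)) ->
  smooth_field f -> f \in @is_form 1 1 su_t.
Proof.
move=> E lh sf; apply/is_formP; split => //.
- by move=> g v i a x y; rewrite !E /upd (ord1 i) eqxx lh.
- by move=> g v i i'; rewrite (ord1 i) (ord1 i') eqxx.
Qed.

Fact mc_left_form_subproof :
  ((fun g v => mc_left_val (v ord0)) : tfield 1 1 su_t) \in @is_form 1 1 su_t.
Proof.
apply: form1P (fun g v => erefl) _ _.
  by move=> g a x y; apply/val_inj; rewrite /= !ffunE linearP.
move=> xi; rewrite (_ : (fun _ => _) = fun=> xi ord0 ord0).
  exact: smooth_map_cst.
by apply/funext => g; apply/val_inj; rewrite /= ffunE cmulA invSU cmul1l.
Qed.

Fact mc_right_form_subproof :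
  ((fun g v => mc_right_val (v ord0)) : tfield 1 1 su_t) \in @is_form 1 1 su_t.
Proof.
apply: form1P (fun g v => erefl) _ _.
  by move=> g a x y; apply/val_inj; rewrite /= !ffunE linearPl.
move=> xi; rewrite (_ : (fun _ => _) = @vsproj _ _ (su R n) \o
  (fun g : BG 1 => cmul (cmul (g ord0) (vsval (xi ord0 ord0))) (cadj (g ord0)))).
  apply: smooth_map_linear; apply: smooth_map_bilinear.
    apply: smooth_map_bilinear; first exact: smooth_map_coord.
    exact: smooth_map_cst.
  apply: (@smooth_map_linear _ _ _ _ _ (@cadj R n)).
  exact: smooth_map_coord.
apply/funext => g /=; rewrite -SubvsE.
  by apply: Ad_su; exact: subvsP.
by move=> h; apply/val_inj; rewrite /= ffunE invSU_adj.
Qed.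

Definition mc_left : form 1 1 su_t := Form mc_left_form_subproof.
Definition mc_right : form 1 1 su_t := Form mc_right_form_subproof.
End MaurerCartan.

(* Omega^4(BG_0) + Omega^3(BG_1) + Omega^2(BG_2) + Omega^1(BG_3) + Omega^0(BG_4) *)
Definition total4 (V : vectType R) : Type :=
  (form 0 4 V * form 1 3 V * form 2 2 V * form 3 1 V * form 4 0 V)%type.

End Forms.

Section CharacteristicForms.
Variables (R : realType) (n : nat).
Local Notation su_t := (subvs_of (su R n)).

(* The face maps d_0 (g1, g2) = g2 and d_2 (g1, g2) = g1; indices start at 0,  *)
(* so g1 and g2 are the values at ord0 and ord_max of 'I_2.                    *)
Definition d0_pullback k (V : vectType R) (phi : form n 1 k V) : form n 2 k V :=
  pullback (fun _ : 'I_1 => ord_max : 'I_2) phi.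
Definition d2_pullback k (V : vectType R) (phi : form n 1 k V) : form n 2 k V :=
  pullback (fun _ : 'I_1 => ord0 : 'I_2) phi.

Definition Psi (c : R) : total4 n R^o :=
  (0,
   - (1 / 6%:R : R) *:
     wedge (pairing c) (mc_left R n)
       (wedge (@su_bracket R n) (mc_left R n) (mc_left R n)),
   wedge (pairing c) (d0_pullback (mc_left R n)) (d2_pullback (mc_right R n)),
   0, 0).

(* The Maurer-Cartan forms as matrix-valued forms. *)
Definition theta_left : form n 1 1 (cmx R n) := postcomp vsval (mc_left R n).
Definition theta_right : form n 1 1 (cmx R n) := postcomp vsval (mc_right R n).

(* The map induced by (A, B, C) |-> Tr(ABC) on the triple tensor product is    *)
(* the one induced by (D, C) |-> Tr(DC) after (A, B) |-> D = AB. Traces of     *)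
(* complex matrices are complex, so Phi is a priori a complex-valued cochain.  *)
Definition Phi : total4 n (Rcomplex R) :=
  (0,
   (1 / (24%:R * pi ^+ 2) : R) *:
     wedge (@trmul R n) (wedge (@cmul R n) theta_left theta_left) theta_left,
   (1 / (8%:R * pi ^+ 2) : R) *:
     wedge (@trmul R n) (d2_pullback theta_right) (d0_pullback theta_left),
   0, 0).

Definition to_complex (x : R^o) : Rcomplex R := (x : R)%:C.
Fact to_complex_linear : linear to_complex.
Proof.
move=> a x y; apply/eqP; rewrite eq_complex /=.
by rewrite mulr0 addr0 !eqxx.
Qed.
HB.instance Definition _ :=
  GRing.isLinear.Build R R^o (Rcomplex R) _ to_complex to_complex_linear.

(* Real forms regarded as complex-valued forms: an equality                    *)
(* complexify x = y says that y is real-valued and equal to x.                 *)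
Definition complexify (x : total4 n R^o) : total4 n (Rcomplex R) :=
  let: (x4, x3, x2, x1, x0) := x in
  (postcomp to_complex x4, postcomp to_complex x3, postcomp to_complex x2,
   postcomp to_complex x1, postcomp to_complex x0).

End CharacteristicForms.

Arguments Psi {R} n c.

(* Main.v *)
From HB Require Import structures.
From mathcomp Require Import fingroup perm.
Require Import Defs.
From mathcomp Require Import all_boot all_order all_algebra.
From mathcomp Require Import all_classical all_reals all_analysis.
From mathcomp.real_closed Require Import complex.
From mathcomp Require Import ring.

Set Implicit Arguments.
Unset Strict Implicit.
Unset Printing Implicit Defensive.

Import Order.TTheory GRing.Theory Num.Theory.
Local Open Scope ring_scope.

(** Everything rests on the identity K(X, Y) = 2n Tr(XY) for the Killing form
    of su(n), [killing_trace]; it turns c K into 2nc times the trace form.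

    The identity comes from comparing two traces.  The operator
    T = [X, [Y, _]] is complex linear on all n x n matrices, where its complex
    trace is 2n Tr(XY) - 2 Tr X Tr Y = 2n Tr(XY): the terms XYZ and ZYX
    contribute n Tr(XY) each, while XZY and YZX contribute Tr X Tr Y each
    ([sum_double_commutator_delta]).  On the other hand su(n), enlarged by the
    imaginary scalars that T kills, is a real form of the complex matrices,
    so the real trace of T on su(n) is the real part of its complex trace
    ([lftrace_su]).  No basis of su(n) is needed for this: a trace can be read
    off any finite decomposition v = sum_i l_i(v) e_i of the identity, even
    when the e_i are linearly dependent ([lftrace_frame]), and the orthogonal
    projections of the matrix units E_ij and i E_ij provide one.  Finally
    Tr(XY) is real because X and Y are skew-Hermitian.

    In degree (1, 3), the bracket gives
    [theta, theta](u, v) = 2 (theta . theta)(u, v), and the invariance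
    Tr(A [B, D]) = Tr([A, B] D) moves the commutator from the last two factors
    to the first two; the two integrands then agree permutation by
    permutation, up to the factor 2 . 2nc = 4nc ([wedge_pairing_bracket]).
    In degree (2, 2), the two 1-forms come in opposite orders, and exchanging
    them costs the sign of a transposition, whence the factor -2nc
    ([wedge_pairing_faces]).  Multiplying by -1 / (16 n c pi^2), and by the
    further -1/6 in the first case, gives 1 / (24 pi^2) and 1 / (8 pi^2). *)

(** * Traces *)

(** With b a basis, expand f b_a = sum_i l_i(b_a) f(e_i) and then recognize
    sum_a l_i(b_a) coord_a(f(e_i)) as l_i applied to the expansion of f(e_i)
    in b.  The e_i need not be independent, which is what allows projections
    of a basis of an ambient space. *)
Lemma lftrace_frame (K : fieldType) (V : vectType K) (I : finType)
    (e : I -> V) (l : I -> {linear V -> K^o}) (f : 'End(V)) :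
  (forall v, v = \sum_i l i v *: e i) -> lftrace f = \sum_i l i (f (e i)).
Proof.
move=> frame; set b := vbasis {:V}.
have -> : lftrace f = \sum_(a < \dim {:V}) coord b a (f b`_a).
  rewrite /lftrace /mxtrace; apply: eq_bigr => a _.
  by rewrite !mxE /= passmx.vecof_delta.
transitivity (\sum_(a < \dim {:V}) \sum_i l i b`_a * coord b a (f (e i))).
  apply: eq_bigr => a _; rewrite [X in f X]frame !linear_sum.
  by apply: eq_bigr => i _; rewrite !linearZ.
rewrite exchange_big; apply: eq_bigr => i _ /=.
rewrite [f (e i) in RHS](coord_vbasis (memvf _)) linear_sum.
by apply: eq_bigr => a _; rewrite linearZ /= [LHS]mulrC.
Qed.

Section KillingForm.
Variables (R : rcfType) (n : nat).
Local Notation M := (cmx R n).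
Local Notation su_t := (subvs_of (su R n)).
Local Notation C := R[i].

(** * The orthogonal projection onto su(n) *)

Definition skew_part (Z : M) : M := 2^-1 *: (Z - cadj Z).
Definition su_proj (Z : M) : M :=
  skew_part Z - (((n%:R : C)^-1 * \tr (skew_part Z : 'M[C]_n))%:M : 'M[C]_n).

Fact skew_part_linear : linear skew_part.
Proof.
move=> a Z W; rewrite /skew_part linearP opprD addrACA -scalerBr scalerDr.
by rewrite !scalerA mulrC.
Qed.
HB.instance Definition _ := GRing.isLinear.Build R M M _ skew_part
  skew_part_linear.

Fact su_proj_linear : linear su_proj.
Proof.
move=> a Z W; rewrite /su_proj linearP /= !cmxZE linearP /= mulrDr raddfD /=.
rewrite mulrCA -[(_ * (_ * _))%:M]scale_scalar_mx.
by rewrite scalerBr opprD addrACA.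
Qed.
HB.instance Definition _ := GRing.isLinear.Build R M M _ su_proj su_proj_linear.

Lemma cadj_skew_part (Z : M) : cadj (skew_part Z) = - skew_part Z.
Proof. by rewrite /skew_part linearZ /= linearB /= cadjK -scalerN opprB. Qed.

Lemma su_projP (Z : M) : (0 < n)%N -> su_proj Z \in su R n.
Proof.
move=> n0; have n0C : n%:R != 0 :> C by rewrite pnatr_eq0 -lt0n.
apply/suP; split.
  have tr_skew : (\tr (skew_part Z : 'M[C]_n))^* = - \tr (skew_part Z : 'M[C]_n).
    have := congr1 (@mxtrace C n) (cadj_skew_part Z).
    by rewrite /cadj trace_map_mx mxtrace_tr raddfN.
  rewrite /su_proj linearB /= cadj_skew_part opprB addrC; congr (_ + _).
  rewrite /cadj tr_scalar_mx map_scalar_mx -raddfN /=; congr (_%:M).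
  by rewrite rmorphM fmorphV rmorph_nat /= tr_skew mulrN opprK.
rewrite /ctrace raddfB /= mxtrace_scalar -mulrnAr.
by rewrite -[\tr _ *+ n]mulr_natl mulKf // subrr.
Qed.

Lemma su_proj_id (Z : su_t) : su_proj (vsval Z) = vsval Z.
Proof.
have /suP[adjZ trZ] := subvsP Z.
have skewZ : skew_part (vsval Z) = vsval Z.
  by rewrite /skew_part adjZ opprK -mulr2n -scaler_nat scalerA mulVf ?pnatr_eq0 // scale1r.
by rewrite /su_proj skewZ [\tr _]trZ mulr0 raddf0 subr0.
Qed.

(** * Real coordinates on complex matrices *)

(** The Boolean is true for the imaginary part, here and for the imaginary
    direction in [cunit], so that one finite type indexes the real coordinates
    together with the vectors dual to them. *)
Definition entry (b : bool) (i j : 'I_n) (Z : M) : R^o :=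
  if b then complex.Im ((Z : 'M[C]_n) i j) else complex.Re ((Z : 'M[C]_n) i j).
Arguments entry : simpl never.

Fact entry_linear b i j : linear (entry b i j).
Proof.
move=> a Z W; rewrite /entry cmxZE !mxE.
case: b; case: (Z i j) => x y; case: (W i j) => z t /=.
  by rewrite mul0r addr0.
by rewrite mul0r subr0.
Qed.
HB.instance Definition _ b i j := GRing.isLinear.Build R M R^o _ (entry b i j)
  (entry_linear b i j).

Definition cunit (b : bool) (i j : 'I_n) : M :=
  (if b then Complex 0 1 else 1 : C) *: (delta_mx i j : 'M[C]_n).

Lemma cmx_frame (Z : M) :
  Z = \sum_(p : bool * ('I_n * 'I_n))
        entry p.1 p.2.1 p.2.2 Z *: cunit p.1 p.2.1 p.2.2.
Proof.
rewrite -(pair_bigA _ (fun b (q : 'I_n * 'I_n) =>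
  entry b q.1 q.2 Z *: cunit b q.1 q.2)).
rewrite big_bool /= -big_split /=.
rewrite -(pair_bigA _ (fun i j =>
  entry true i j Z *: cunit true i j + entry false i j Z *: cunit false i j)).
rewrite [LHS]matrix_sum_delta; apply: eq_bigr => i _; apply: eq_bigr => j _.
rewrite !cmxZE /cunit !scalerA.
(* Addition of [cmx] is that of matrices, but only up to conversion. *)
have addE (a b : C) (A : 'M[C]_n) : (a *: A : M) + (b *: A : M) = (a + b) *: A.
  exact: (esym (scalerDl A a b)).
rewrite addE; apply: (congr1 (fun c : C => c *: (delta_mx i j : 'M[C]_n))).
rewrite /entry; case: (Z i j) => x y.
apply/eqP; rewrite eq_complex /=.
by rewrite ?(mulr0, mul0r, mulr1, oppr0, addr0, add0r) !eqxx.
Qed.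

(** * The double commutator as a complex linear operator *)

Fact commutator_linear (X : M) : linear (commutator X).
Proof.
move=> a Y Z; rewrite /commutator !linearPl !linearPr /=.
by rewrite scalerBr opprD addrACA.
Qed.
HB.instance Definition _ X := GRing.isLinear.Build R M M _ (commutator X)
  (commutator_linear X).

(** [su_proj Z] and [skew_part Z] differ by a scalar matrix, which is central. *)
Lemma commutator_su_projE (Y Z : M) :
  commutator Y (su_proj Z) = commutator Y (skew_part Z).
Proof.
have central a : commutator Y (a%:M : 'M[C]_n) = 0.
  by rewrite /commutator /cmul mul_mx_scalar mul_scalar_mx; exact: subrr.
by rewrite /su_proj linearB /= central subr0.
Qed.

Definition double_commutator (X Y Z : M) := commutator X (commutator Y Z).

Fact double_commutator_linear X Y : linear (double_commutator X Y).
Proof. by move=> a Z W; rewrite /double_commutator !linearP. Qed.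
HB.instance Definition _ X Y := GRing.isLinear.Build R M M _
  (double_commutator X Y) (double_commutator_linear X Y).

Lemma double_commutatorZ X Y (a : C) (Z : M) :
  double_commutator X Y (a *: (Z : 'M[C]_n)) =
  a *: (double_commutator X Y Z : 'M[C]_n).
Proof.
have commutatorZ (W : M) (D : 'M[C]_n) :
    commutator W (a *: D) = a *: (commutator W D : 'M[C]_n).
  rewrite /commutator /cmul -scalemxAr -scalemxAl.
  exact: (esym (scalerBr a (W *m D : 'M[C]_n) (D *m W : 'M[C]_n))).
by rewrite /double_commutator !commutatorZ.
Qed.

Lemma mul_delta_mul (A B : 'M[C]_n) i j k l :
  (A *m delta_mx i j *m B) k l = A k i * B j l.
Proof.
rewrite -(mul_delta_mx (0 : 'I_1)) mulmxA -mulmxA -colE -rowE.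
by rewrite mxE big_ord1 !mxE.
Qed.

Lemma double_commutator_delta (X Y : 'M[C]_n) i j :
  (double_commutator X Y (delta_mx i j : 'M[C]_n) : 'M[C]_n) i j =
  (X *m Y) i i - X i i * Y j j - (Y i i * X j j - (Y *m X) j j).
Proof.
set E := delta_mx i j.
have -> : double_commutator X Y E =
    X *m Y *m E *m 1%:M - X *m E *m Y - (Y *m E *m X - 1%:M *m E *m (Y *m X)).
  by rewrite /double_commutator /commutator /cmul mulmxBr mulmxBl mul1mx mulmx1 !mulmxA.
have entryB (A B : 'M[C]_n) k l : (A - B) k l = A k l - B k l by rewrite !mxE.
by rewrite !entryB !mul_delta_mul !mxE !eqxx mulr1 mul1r.
Qed.

(** The left-hand side is the complex trace of the double commutator in the
    basis of matrix units. *)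
Lemma sum_double_commutator_delta (X Y : 'M[C]_n) :
  \sum_i \sum_j (double_commutator X Y (delta_mx i j : 'M[C]_n) : 'M[C]_n) i j =
  \tr (X *m Y) *+ (2 * n) - \tr X * \tr Y *+ 2.
Proof.
under eq_bigr => i _.
  under eq_bigr => j _ do rewrite double_commutator_delta.
  rewrite sumrB sumrB sumrB sumr_const card_ord -!mulr_sumr.
  over.
rewrite !sumrB sumr_const card_ord -!mulr_suml !sumrMnl.
rewrite -[\sum_i X i i]/(\tr X) -[\sum_i Y i i]/(\tr Y).
rewrite -[\sum_i (X *m Y) i i]/(\tr (X *m Y)) -[\sum_i (Y *m X) i i]/(\tr (Y *m X)).
rewrite [\tr (Y *m X)]mxtrace_mulC [\tr Y * _]mulrC mulnC mulrnA.
by rewrite -mulrnBl mulr2n opprB.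
Qed.

(** * The Killing form as a trace form *)

Lemma entry_imaginary i j (Z : M) :
  entry true i j ('i%C *: (Z : 'M[C]_n)) = entry false i j Z.
Proof. by rewrite /entry mxE; case: (Z i j) => x y /=; rewrite mul0r mul1r add0r. Qed.

Lemma cadj_cunit b i j :
  cadj (cunit b i j) = (if b then - cunit true j i else cunit false j i).
Proof.
rewrite /cadj /cunit; case: b; last by rewrite !scale1r trmx_delta map_delta_mx.
apply/matrixP => k l; rewrite !mxE rmorphM /= rmorph_nat andbC -mulNr.
by congr (_ * _); apply/eqP; rewrite eq_complex /= oppr0 !eqxx.
Qed.

(** The real and the imaginary direction at (i, j) contribute
    Re (T E_ij - T E_ji)_ij / 2 and Re (T E_ij + T E_ji)_ij / 2: conjugate
    transposition sends E_ij to E_ji but i E_ij to - i E_ji, and T commutes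
    with i.  The terms in E_ji therefore cancel. *)
Lemma entry_skew_part_linear (T : {linear M -> M}) i j :
  (forall (a : C) (Z : M),
     T (a *: (Z : 'M[C]_n)) = a *: (T Z : 'M[C]_n)) ->
  entry true i j (T (skew_part (cunit true i j))) +
    entry false i j (T (skew_part (cunit false i j))) =
  complex.Re ((T (delta_mx i j : 'M[C]_n) : 'M[C]_n) i j).
Proof.
move=> TZ; rewrite -[RHS]/(entry false i j (T (delta_mx i j : 'M[C]_n))).
have entry_skew b (Z : M) : entry b i j (T (skew_part Z)) =
    2^-1 * (entry b i j (T Z) - entry b i j (T (cadj Z))).
  by rewrite /skew_part !linearZ !linearB.
have T_imag k m : entry true i j (T (cunit true k m)) =
    entry false i j (T (delta_mx k m : 'M[C]_n)).
  by rewrite /cunit TZ entry_imaginary.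
rewrite !entry_skew !cadj_cunit !linearN /= !T_imag.
rewrite opprK /cunit !scale1r -mulrDr addrACA subrr addr0 -mulr2n.
by apply: (canLR (mulKf _)); rewrite ?pnatr_eq0 // mulr_natl.
Qed.

(** The real trace on su(n) is the real part of a complex trace.  The second
    hypothesis says that f is induced by T and that T does not see the scalar
    matrix by which [su_proj] and [skew_part] differ. *)
Lemma lftrace_su (f : 'End(su_t)) (T : {linear M -> M}) (n0 : (0 < n)%N) :
  (forall (a : C) (Z : M),
     T (a *: (Z : 'M[C]_n)) = a *: (T Z : 'M[C]_n)) ->
  (forall Z : M, vsval (f (Subvs (su_projP Z n0))) = T (skew_part Z)) ->
  lftrace f =
    complex.Re (\sum_i \sum_j (T (delta_mx i j : 'M[C]_n) : 'M[C]_n) i j).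
Proof.
move=> TZ fT.
pose e (p : bool * ('I_n * 'I_n)) : su_t :=
  Subvs (su_projP (cunit p.1 p.2.1 p.2.2) n0).
pose l (p : bool * ('I_n * 'I_n)) : {linear su_t -> R^o} :=
  entry p.1 p.2.1 p.2.2 \o vsval.
have frame (Z : su_t) : Z = \sum_p l p Z *: e p.
  apply/val_inj; rewrite -[LHS]su_proj_id {1}[vsval Z]cmx_frame !linear_sum.
  by apply: eq_bigr => p _; rewrite !linearZ.
rewrite (lftrace_frame _ frame).
rewrite pair_bigA raddf_sum /=.
rewrite -(pair_bigA _ (fun b (q : 'I_n * 'I_n) => l (b, q) (f (e (b, q))))).
rewrite big_bool -big_split; apply: eq_bigr => -[i j] _ /=.
by rewrite !fT; exact: entry_skew_part_linear.
Qed.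

Lemma killing_Re_trace (X Y : su_t) : (0 < n)%N ->
  killing X Y =
    (2 * n)%:R * complex.Re (\tr ((vsval X : 'M[C]_n) *m (vsval Y : 'M[C]_n))).
Proof.
move=> n0.
rewrite /killing (@lftrace_su _ (double_commutator (vsval X) (vsval Y)) n0).
- rewrite sum_double_commutator_delta.
  have /suP[_ trX] := subvsP X.
  rewrite [\tr (vsval X)]trX mul0r mul0rn subr0.
  by rewrite raddfMn /= mulr_natl.
- exact: double_commutatorZ.
- by move=> Z; rewrite comp_lfunE !lfunE /= commutator_su_projE.
Qed.

(** Conjugation fixes Tr(XY): it becomes Tr(Y^* X^* ) = Tr(YX), the two signs
    of the skew-Hermitian X and Y cancelling. *)
Lemma Im_trace_mul_su (X Y : su_t) :
  complex.Im (\tr ((vsval X : 'M[C]_n) *m (vsval Y : 'M[C]_n))) = 0.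
Proof.
have /suP[adjX _] := subvsP X; have /suP[adjY _] := subvsP Y.
have : ctrace (cadj (cmul (vsval X) (vsval Y))) = ctrace (cmul (vsval X) (vsval Y)).
  by rewrite cadjM adjX adjY linearNl linearNr opprK ctrace_mulC.
rewrite {1}/ctrace /cadj trace_map_mx mxtrace_tr /ctrace /cmul.
case: (\tr _) => x y /= [] /eqP; rewrite eq_sym -addr_eq0 -mulr2n mulrn_eq0 /=.
by move/eqP.
Qed.

Lemma killing_trace (X Y : su_t) : (0 < n)%N ->
  ((killing X Y)%:C)%C =
    \tr ((vsval X : 'M[C]_n) *m (vsval Y : 'M[C]_n)) *+ (2 * n).
Proof.
move=> n0; rewrite killing_Re_trace // rmorphM /= rmorph_nat mulr_natl; congr (_ *+ _).
move: (Im_trace_mul_su X Y).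
by case: (\tr _) => x y /= ->.
Qed.

(** Invariance of the trace form, which is cyclicity of the trace. *)
Lemma trmul_commutator (A B D : M) :
  trmul A (commutator B D) = trmul (commutator A B) D.
Proof.
rewrite /trmul /commutator linearBr linearBl /= !linearB /=; congr (_ - _).
  by rewrite cmulA.
by rewrite cmulA ctrace_mulC cmulA.
Qed.

Lemma commutatorN (A B : M) : commutator B A = - commutator A B.
Proof. by rewrite /commutator opprB. Qed.

End KillingForm.

(** * Wedge products of 1-forms *)

Section LowDegreeForms.
Variables (R : realType) (n : nat).
Local Notation su_t := (subvs_of (su R n)).
Local Notation form := Defs.form.

Lemma form_ext p k (V : vectType R) (phi psi : form n p k V) :
  (forall g (v : 'I_k -> subvs_of (tangent g)), form_val phi v = form_val psi v) ->
  phi = psi.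
Proof. by move=> h; apply/val_inj/tfieldP. Qed.

Lemma postcompZ p k (V W : vectType R) (h : {linear V -> W}) (a : R)
    (phi : form n p k V) :
  postcomp h (a *: phi) = a *: postcomp h phi.
Proof. by apply: form_ext => g v; exact: linearZ. Qed.

Lemma postcomp0 p k (V W : vectType R) (h : {linear V -> W}) :
  postcomp h (0 : form n p k V) = 0.
Proof. by apply: form_ext => g v; exact: linear0. Qed.

Lemma perm_ord2 (s : 'S_2) : s = 1%g \/ s = tperm ord0 ord_max.
Proof.
have ord2P (i : 'I_2) : i = ord0 \/ i = ord_max.
  by case: i => [[|[|//]] ?]; [left|right]; apply/val_inj.
have s_neq i : s ord0 = i -> s ord_max <> i.
  by move=> <- /perm_inj.
case: (ord2P (s ord0)) => s0; case: (ord2P (s ord_max)) => s1;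
  [by case: (s_neq _ s0) | left | right | by case: (s_neq _ s0)];
  by apply/perm.permP => i; case: (ord2P i) => ->; rewrite ?perm1 ?tpermL ?tpermR.
Qed.

Lemma wedge11E p (U V W : vectType R) (B : {bilinear U -> V -> W})
    (phi : form n p 1 U) (psi : form n p 1 V) g
    (v : 'I_2 -> subvs_of (tangent g)) :
  form_val (wedge B phi psi) v =
    B (form_val phi (fun=> v ord0)) (form_val psi (fun=> v ord_max)) -
    B (form_val phi (fun=> v ord_max)) (form_val psi (fun=> v ord0)).
Proof.
rewrite /= /wedge_field /= invr1 scale1r.
have tperm_neq1 : tperm ord0 ord_max != 1%g :> 'S_2.
  by apply/eqP => /perm.permP/(_ ord0); rewrite tpermL perm1.
rewrite (bigD1 1%g) //= (bigD1 (tperm ord0 ord_max)) //= big1 ?addr0; last first.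
  by move=> s; case: (perm_ord2 s) => ->; rewrite eqxx ?andbF.
rewrite odd_perm1 odd_tperm /= expr0 expr1 scale1r scaleN1r.
have argE (s : 'S_2) (f : 'I_1 -> 'I_2) i : f ord0 = i ->
    (fun a => v (s (f a))) = (fun=> v (s i)).
  by move=> <-; apply/funext => a; rewrite (ord1 a).
have l0 : @lshift 1 1 ord0 = ord0 :> 'I_2 by exact/val_inj.
have r0 : @rshift 1 1 ord0 = ord_max :> 'I_2 by exact/val_inj.
by rewrite !(argE _ _ _ l0) !(argE _ _ _ r0) !perm1 tpermL tpermR.
Qed.

Local Notation mid3 := (Ordinal (isT : 1 < 3)%N : 'I_3).

(** In both triple wedge products the factorials leave 1/2, and the inner wedge
    is evaluated on the arguments that the outer permutation assigns to it; the
    two sums are thus indexed by the same permutations of three arguments and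
    can be compared term by term. *)
Lemma wedge_1_11E p (U V W X Y : vectType R) (B : {bilinear U -> V -> W})
    (B' : {bilinear X -> Y -> V}) (phi : form n p 1 U) (psi : form n p 1 X)
    (chi : form n p 1 Y) g (v : 'I_3 -> subvs_of (tangent g)) :
  form_val (wedge B phi (wedge B' psi chi)) v =
  2^-1 *: \sum_(s : 'S_3) ((-1) ^+ s : R) *:
    B (form_val phi (fun=> v (s ord0)))
      (B' (form_val psi (fun=> v (s mid3))) (form_val chi (fun=> v (s ord_max))) -
       B' (form_val psi (fun=> v (s ord_max))) (form_val chi (fun=> v (s mid3)))).
Proof.
transitivity (wedge_field B phi (wedge B' psi chi) v) => //; rewrite /wedge_field.
have i0E a : @lshift 1 2 a = ord0 by apply/val_inj; rewrite (ord1 a).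
have i1E : @rshift 1 2 ord0 = mid3 by exact/val_inj.
have i2E : @rshift 1 2 ord_max = ord_max by exact/val_inj.
congr (_ *: _); apply: eq_bigr => s _; rewrite wedge11E i1E i2E.
have argE : (fun a => v (s (@lshift 1 2 a))) = (fun=> v (s ord0)).
  by apply/funext => a; rewrite i0E.
by rewrite argE.
Qed.

Lemma wedge_11_1E p (U V W X Y : vectType R) (B : {bilinear V -> U -> W})
    (B' : {bilinear X -> Y -> V}) (phi : form n p 1 X) (psi : form n p 1 Y)
    (chi : form n p 1 U) g (v : 'I_3 -> subvs_of (tangent g)) :
  form_val (wedge B (wedge B' phi psi) chi) v =
  2^-1 *: \sum_(s : 'S_3) ((-1) ^+ s : R) *:
    B (B' (form_val phi (fun=> v (s ord0))) (form_val psi (fun=> v (s mid3))) -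
       B' (form_val phi (fun=> v (s mid3))) (form_val psi (fun=> v (s ord0))))
      (form_val chi (fun=> v (s ord_max))).
Proof.
transitivity (wedge_field B (wedge B' phi psi) chi v) => //; rewrite /wedge_field.
have i2E a : @rshift 2 1 a = ord_max by apply/val_inj; rewrite (ord1 a).
have i1E : @lshift 2 1 ord_max = mid3 by exact/val_inj.
have i0E : @lshift 2 1 ord0 = ord0 by exact/val_inj.
congr (_ *: _); apply: eq_bigr => s _; rewrite wedge11E i1E i0E.
have argE : (fun b => v (s (@rshift 2 1 b))) = (fun=> v (s ord_max)).
  by apply/funext => b; rewrite i2E.
by rewrite argE.
Qed.

(** * Comparison of the two cochains *)

Lemma pairing_trace (c : R) (X Y : su_t) : (0 < n)%N ->
  to_complex (pairing c X Y) = (2%:R * n%:R * c) *: trmul (vsval X) (vsval Y).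
Proof.
move=> n0; rewrite /pairing.
have killing_trmul :
    to_complex (killing X Y) = (2%:R * n%:R) *: trmul (vsval X) (vsval Y).
  by rewrite -natrM scaler_nat; exact: killing_trace.
transitivity (c *: to_complex (killing X Y)); first exact: linearZ.
by rewrite killing_trmul scalerA mulrC.
Qed.

(** The difference of brackets is the value of the wedge [theta, theta] on two
    vectors, which is twice the bracket; this doubles the factor 2nc. *)
Lemma pairing_bracket_trace (c : R) (X Y Z : su_t) : (0 < n)%N ->
  to_complex (pairing c X (su_bracket Y Z - su_bracket Z Y)) =
  (4%:R * n%:R * c) *:
    trmul (commutator (vsval X) (vsval Y)) (vsval Z).
Proof.
move=> n0; have -> : to_complex (pairing c X (su_bracket Y Z - su_bracket Z Y)) =
    to_complex (pairing c X (su_bracket Y Z)) -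
      to_complex (pairing c X (su_bracket Z Y)).
  by rewrite linearBr; exact: linearB.
rewrite !pairing_trace //= [commutator (vsval Z) _]commutatorN.
have -> : trmul (vsval X) (- commutator (vsval Y) (vsval Z)) =
    - trmul (vsval X) (commutator (vsval Y) (vsval Z)) by exact: linearNr.
rewrite trmul_commutator scalerN opprK -scalerDl; congr (_ *: _).
by ring.
Qed.

Lemma wedge_pairing_bracket (c : R) : (0 < n)%N ->
  postcomp (@to_complex R) (wedge (pairing c) (mc_left R n)
    (wedge (@su_bracket R n) (mc_left R n) (mc_left R n))) =
  (4%:R * n%:R * c) *:
    (wedge (@trmul R n) (wedge (@cmul R n) (theta_left R n) (theta_left R n))
      (theta_left R n) : form n 1 3 (Rcomplex R)).
Proof.
move=> n0; apply: form_ext => g v.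
(* Naming the values of both sides keeps the wedge products folded. *)
transitivity (to_complex (form_val (wedge (pairing c) (mc_left R n)
    (wedge (@su_bracket R n) (mc_left R n) (mc_left R n))) v)) => //.
transitivity ((4%:R * n%:R * c) *: form_val (wedge (@trmul R n)
    (wedge (@cmul R n) (theta_left R n) (theta_left R n)) (theta_left R n)) v) => //.
rewrite wedge_1_11E wedge_11_1E linearZ linear_sum /=.
rewrite [RHS]scalerA [in RHS]mulrC -[RHS]scalerA [in RHS]scaler_sumr.
congr (_ *: _); apply: eq_bigr => s _.
rewrite linearZ /= pairing_bracket_trace // [RHS]scalerA [in RHS]mulrC.
by rewrite -[RHS]scalerA.
Qed.

Lemma wedge_pairing_faces (c : R) : (0 < n)%N ->
  postcomp (@to_complex R) (wedge (pairing c)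
    (d0_pullback (mc_left R n)) (d2_pullback (mc_right R n))) =
  - (2%:R * n%:R * c) *:
    wedge (@trmul R n) (d2_pullback (theta_right R n)) (d0_pullback (theta_left R n)).
Proof.
move=> n0; apply: form_ext => g v.
transitivity (to_complex (form_val (wedge (pairing c)
    (d0_pullback (mc_left R n)) (d2_pullback (mc_right R n))) v)) => //.
transitivity (- (2%:R * n%:R * c) *: form_val (wedge (@trmul R n)
    (d2_pullback (theta_right R n)) (d0_pullback (theta_left R n))) v) => //.
rewrite !wedge11E linearB /= !pairing_trace // -scalerBr scaleNr -scalerN opprB.
by congr (_ *: (_ - _)); exact: ctrace_mulC.
Qed.

End LowDegreeForms.

Theorem theorem5p4p10 (R : realType) (n : nat) (c : R)
    (hn : (2 <= n)%N) (hc : c != 0) :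
  complexify (- (1 / (16%:R * n%:R * c * pi ^+ 2)) *: Psi n c) = Phi R n.
Proof.
have n0 : (0 < n)%N by exact: ltnW.
have nR0 : n%:R != 0 :> R by rewrite pnatr_eq0 -lt0n.
have pi0 : pi != 0 :> R by rewrite gt_eqF // pi_gt0.
congr (_, _, _, _, _).
- by rewrite scaler0 postcomp0.
- rewrite scalerA postcompZ wedge_pairing_bracket // scalerA.
  congr (_ *: _); move: (pi : R) pi0 => q q0; field.
  by rewrite hc nR0 q0.
- rewrite postcompZ wedge_pairing_faces // scalerA.
  congr (_ *: _); move: (pi : R) pi0 => q q0; field.
  by rewrite hc nR0 q0.
- by rewrite scaler0 postcomp0.
- by rewrite scaler0 postcomp0.
Qed.
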